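(* Let $n,r$ be positive integers, $v\in\mathbb{R}^n$, let $\widetilde f:\mathbb{R}^{n\times r}\to\mathbb{R}$ be continuously differentiable, and set $f(X):=\widetilde f(\sqrt n\,X)$. Consider the problems $$(P)\quad \min_{B\in\mathbb{R}^{n\times r}}\widetilde f(B)\ \ \text{s.t.}\ \ B\in\{-1,1\}^{n\times r},\ B^\top B=nI_r,\ B^\top v=0,$$ $$(Q)\quad \min_{X\in\mathbb{R}^{n\times r}} f(X)\ \ \text{s.t.}\ \ X^\top X=I_r,\ X^\top v=0,\ X\in\Lambda .$$ Under the change of variables $X=\frac{1}{\sqrt n}B$, problem $(Q)$ is equivalent to problem $(P)$ in the sense that they have the same global optimal solution set and the same local optimal solution set (i.e. $B$ is a global, respectively local, optimal solution of $(P)$ if and only if $\frac1{\sqrt n}B$ is a global, respectively local, optimal solution of $(Q)$). Moreover, each feasible point of $(Q)$ is a local optimal solution of $(Q)$.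
   Context: $\Lambda:=\{X\in\mathbb{R}^{n\times r} : |X_{ij}|\le \frac{1}{\sqrt n}\ \text{for all } i,j\}$. $\mathbb{R}^{n\times r}$ carries the Frobenius norm. $I_r$ is the $r\times r$ identity matrix. A local optimal solution is a feasible point at which the objective is minimal among all feasible points in some neighbourhood of it. *)

(* Defs.v *)
From mathcomp Require Import all_boot all_order all_algebra.
From mathcomp Require Import all_classical all_reals all_analysis.
Set Implicit Arguments.
Unset Strict Implicit.
Unset Printing Implicit Defensive.
Import Order.TTheory GRing.Theory Num.Theory.
Import numFieldNormedType.Exports.
Local Open Scope classical_set_scope.
Local Open Scope ring_scope.

(* The library's own norm `|X| on matrices is the entrywise max norm. *)
Definition frobenius_norm (R : realType) (n r : nat) (X : 'M[R]_(n, r)) : R :=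
  Num.sqrt (\sum_i \sum_j X i j ^+ 2).

(* Gradient for the inner product (G, H) |-> \tr (G^T *m H). *)
Definition gradient (R : realType) (n r : nat) (f : 'M[R]_(n, r) -> R^o)
    (X : 'M[R]_(n, r)) : 'M[R]_(n, r) :=
  \matrix_(i, j) ('d f X (delta_mx i j) : R).

(* Differentiability and continuity are taken for the library topology of
   'M[R]_(n, r); the max norm defining it is equivalent to the Frobenius norm,
   so both norms give the same notions. *)
Definition continuously_differentiable (R : realType) (n r : nat)
    (f : 'M[R]_(n, r) -> R^o) : Prop :=
  (forall X : 'M[R]_(n, r), differentiable f X) /\ continuous (gradient f).

Definition Lambda (R : realType) (n r : nat) : set 'M[R]_(n, r) :=
  [set X : 'M[R]_(n, r) | forall i j, `|X i j| <= (Num.sqrt n%:R)^-1].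

Definition feasibleP (R : realType) (n r : nat) (v : 'cV[R]_n) :
    set 'M[R]_(n, r) :=
  [set B : 'M[R]_(n, r) | [/\ forall i j, B i j = -1 \/ B i j = 1,
               B^T *m B = n%:R *: 1%:M &
               B^T *m v = 0]].

Definition feasibleQ (R : realType) (n r : nat) (v : 'cV[R]_n) :
    set 'M[R]_(n, r) :=
  [set X : 'M[R]_(n, r) | [/\ X^T *m X = 1%:M, X^T *m v = 0 & Lambda X]].

Definition global_optimal (R : realType) (n r : nat)
    (F : set 'M[R]_(n, r)) (f : 'M[R]_(n, r) -> R) (X : 'M[R]_(n, r)) : Prop :=
  F X /\ forall Y, F Y -> f X <= f Y.

Definition local_optimal (R : realType) (n r : nat)
    (F : set 'M[R]_(n, r)) (f : 'M[R]_(n, r) -> R) (X : 'M[R]_(n, r)) : Prop :=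
  F X /\ exists2 e : R, 0 < e &
    forall Y, F Y -> frobenius_norm (Y - X) < e -> f X <= f Y.

(* Main.v *)
(* The columns of a feasible X of (Q) are unit vectors with n entries of absolute
   value at most 1/sqrt n, so every entry is 1/sqrt n or -1/sqrt n and the two
   feasible sets correspond under scaling. Distinct matrices with entries in
   {-a, a} are at Frobenius distance at least 2a, so all feasible points are
   isolated, and a fortiori local optima, in both problems. *)
Require Import Defs.
From mathcomp Require Import all_boot all_order all_algebra.
From mathcomp Require Import all_classical all_reals all_analysis.
Import Order.TTheory GRing.Theory Num.Theory.
Import numFieldNormedType.Exports.
Local Open Scope classical_set_scope.
Local Open Scope ring_scope.

Lemma ler_entry_frobenius (R : realType) (n r : nat) (X : 'M[R]_(n, r)) i j :
  `|X i j| <= frobenius_norm X.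
Proof.
rewrite -sqrtr_sqr ler_wsqrtr // (bigD1 i) //= (bigD1 j) //= -addrA lerDl.
by rewrite addr_ge0 ?sumr_ge0 // => k _; rewrite ?sumr_ge0 // => *; rewrite sqr_ge0.
Qed.

(** The radius [a] serves at every point of [F]: a matrix of [F] within Frobenius distance [a] of
    [X] differs from it by less than [a] in each entry, while distinct values in {-a, a} differ by
    2a. *)
Lemma local_optimal_two_valued (R : realType) (n r : nat) (a : R)
    (F : set 'M[R]_(n, r)) (f : 'M[R]_(n, r) -> R) (X : 'M[R]_(n, r)) :
  0 < a -> (forall Y, F Y -> forall i j, Y i j = - a \/ Y i j = a) ->
  local_optimal F f X <-> F X.
Proof.
move=> a_gt0 Fa; split=> [[] //|FX]; split=> //; exists a => // Y FY dYX.
suff -> : Y = X by [].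
apply/matrixP => i j.
have := le_lt_trans (ler_entry_frobenius _ _ _ (Y - X) i j) dYX.
rewrite !mxE ltr_norml => /andP[lo hi].
(* Equal signs close at once. The difference is -2a or 2a otherwise, against [lo] or [hi]
   respectively. *)
have [eY|eY] := Fa _ FY i j; have [eX|eX] := Fa _ FX i j; rewrite eY eX // in lo hi *.
  by move: lo; rewrite -subr_gt0 opprK addrNK oppr_gt0 ltNge ltW.
by move: hi; rewrite opprK gtrDl ltNge ltW.
Qed.

(** With a = 1/sqrt n, the slacks a^2 - X_kj^2 are nonnegative by [Lambda] and sum over column j to
    n * (1/n) - 1 = 0, so each of them vanishes. *)
Lemma orthonormal_Lambda_entry (R : realType) (n r : nat) (X : 'M[R]_(n, r)) :
  (0 < n)%N -> X^T *m X = 1%:M -> Lambda X ->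
  forall i j, X i j = - (Num.sqrt n%:R)^-1 \/ X i j = (Num.sqrt n%:R)^-1.
Proof.
move=> n_gt0 XX LX i j; set a := (Num.sqrt n%:R)^-1.
have nR : (n%:R : R) != 0 by rewrite pnatr_eq0 -lt0n.
have a_ge0 : 0 <= a by rewrite invr_ge0 sqrtr_ge0.
have a2 : a ^+ 2 = n%:R^-1 by rewrite exprVn sqr_sqrtr.
have slack k : 0 <= a ^+ 2 - X k j ^+ 2.
  rewrite subr_ge0 -(real_normK (num_real (X k j))) lerXn2r ?nnegrE //.
have : \sum_k (a ^+ 2 - X k j ^+ 2) = 0.
  (* The (j, j) entry of the Gram matrix is the squared norm of column j. *)
  have /matrixP/(_ j j) := XX; rewrite !mxE eqxx mulr1n => colj.
  rewrite sumrB sumr_const card_ord a2 -[_^-1 *+ _]mulr_natr mulVf //.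
  apply/eqP; rewrite subr_eq0 -colj; apply/eqP/eq_bigr => k _.
  by rewrite !mxE expr2.
move/eqP; rewrite psumr_eq0 // => /allP/(_ i); rewrite mem_index_enum /=.
by rewrite subr_eq0 eq_sym eqf_sqr => /(_ isT)/orP[]/eqP; [right|left].
Qed.

(** The matrix equations just rescale. The sign constraint gives the box bound directly; its
    recovery from (Q) rests on [orthonormal_Lambda_entry]. *)
Lemma feasibleQ_scale (R : realType) (n r : nat) (v : 'cV[R]_n)
    (B : 'M[R]_(n, r)) : (0 < n)%N ->
  feasibleQ v ((Num.sqrt n%:R)^-1 *: B) <-> feasibleP v B.
Proof.
move=> n_gt0; set s : R := Num.sqrt n%:R.
have nR : (n%:R : R) != 0 by rewrite pnatr_eq0 -lt0n.
have s_gt0 : 0 < s by rewrite sqrtr_gt0 ltr0n.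
have s0 : s != 0 by rewrite gt_eqF.
have ss : s^-1 * s^-1 = n%:R^-1 by rewrite -expr2 exprVn sqr_sqrtr.
have gram : (s^-1 *: B)^T *m (s^-1 *: B) = n%:R^-1 *: (B^T *m B).
  by rewrite [(_ *: B)^T]linearZ /= -scalemxAl -scalemxAr scalerA ss.
have ortho : (s^-1 *: B)^T *m v = s^-1 *: (B^T *m v).
  by rewrite [(_ *: B)^T]linearZ /= -scalemxAl.
split=> [[XX Xv LX]|[Bpm BB Bv]]; split.
- move=> i j; have := @orthonormal_Lambda_entry _ _ _ _ n_gt0 XX LX i j.
  rewrite mxE -/s => -[] e; [left|right]; apply: (mulfI (invr_neq0 s0)).
    by rewrite e mulrN1.
  by rewrite e mulr1.
- by rewrite -XX gram scalerA divff // scale1r.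
- by apply: (scalerI (invr_neq0 s0)); rewrite -ortho Xv scaler0.
- by rewrite gram BB scalerA mulVf // scale1r.
- by rewrite ortho Bv scaler0.
- move=> i j; rewrite mxE normrM ger0_norm ?invr_ge0 ?(ltW s_gt0) //.
  by have [->|->] := Bpm i j; rewrite ?normrN normr1 mulr1.
Qed.

Theorem lemma6 (R : realType) (n r : nat) (n_gt0 : (0 < n)%N) (r_gt0 : (0 < r)%N)
    (v : 'cV[R]_n) (ftilde : 'M[R]_(n, r) -> R)
    (ftilde_C1 : continuously_differentiable ftilde) :
  let f := fun X : 'M[R]_(n, r) => ftilde (Num.sqrt n%:R *: X) in
  [/\ forall B : 'M[R]_(n, r),
        global_optimal (feasibleP v) ftilde B <->
        global_optimal (feasibleQ v) f ((Num.sqrt n%:R)^-1 *: B),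
      forall B : 'M[R]_(n, r),
        local_optimal (feasibleP v) ftilde B <->
        local_optimal (feasibleQ v) f ((Num.sqrt n%:R)^-1 *: B) &
      forall X : 'M[R]_(n, r),
        feasibleQ v X -> local_optimal (feasibleQ v) f X].
Proof.
move=> f.
have s_gt0 : 0 < Num.sqrt n%:R :> R by rewrite sqrtr_gt0 ltr0n.
have s0 : Num.sqrt n%:R != 0 :> R by rewrite gt_eqF.
have fV B : f ((Num.sqrt n%:R)^-1 *: B) = ftilde B.
  by rewrite /f scalerA divff // scale1r.
(* In both problems local optimality reduces to feasibility, so the local equivalence becomes that
   of the feasible sets. *)
have locQ X : local_optimal (feasibleQ v) f X <-> feasibleQ v X.
  apply: (@local_optimal_two_valued _ _ _ (Num.sqrt n%:R)^-1).
    by rewrite invr_gt0.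
  by move=> Y [YY _ LY]; apply: orthonormal_Lambda_entry.
have locP B : local_optimal (feasibleP v) ftilde B <-> feasibleP v B.
  by apply: (@local_optimal_two_valued _ _ _ 1) => // Y [].
have feas B := @feasibleQ_scale _ _ _ v B n_gt0.
split=> [B|B|X /locQ //].
- split=> -[FB opt]; split; try exact/feas.
    (* A competitor [Y] of (Q) is compared through sqrt n * Y, whose feasibility for (P) follows by
       scaling back. *)
    move=> Y FY; rewrite fV; apply: opt; apply/feas.
    by rewrite scalerA mulVf // scale1r.
  by move=> Y /feas/opt; rewrite !fV.
- by rewrite locP locQ feas.
Qed.
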